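(* Let $n\ge1$ and let $K,L\subset\mathbb{R}^n$ be convex bounded sets containing the origin, and such that $(-1,1)^n\subset L$. Then \[ \left[\sum_{i=0}^{n}\frac{n}{2n-i}\binom{n}{i}\binom{2n}{i}^{-1} \mathrm{G}_{n}\bigl((K+L)\sim(-1,1)^n\bigr)^{i/n}\right] \mathrm{G}_{n}\Bigl(K\cap\bigl((-L)\sim(-1,1)^n\bigr)\Bigr) \leq\mathrm{G}_{n}\bigl(K+(-1,1)^n\bigr)\,\mathrm{G}_{n}\bigl(L+(-1,1)^n\bigr). \] In particular, taking $L=-K$, for every convex bounded set $K\subset\mathbb{R}^n$ with $(-1,1)^n\subset K$, \[ \sum_{i=0}^{n}\frac{n}{2n-i}\binom{n}{i}\binom{2n}{i}^{-1} \mathrm{G}_{n}\bigl((K-K)\sim(-1,1)^n\bigr)^{i/n} \leq\frac{\mathrm{G}_{n}\bigl(K+(-1,1)^n\bigr)^2} {\mathrm{G}_{n}\bigl(K\sim(-1,1)^n\bigr)}. \]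
   Context: For $M\subset\mathbb{R}^n$, $\mathrm{G}_n(M)=|M\cap\mathbb{Z}^n|$ denotes the lattice point enumerator. For non-empty $A,B\subset\mathbb{R}^n$, $A+B=\{a+b: a\in A,\ b\in B\}$ is the Minkowski sum, $A-B=A+(-B)$, and $A\sim B=\{x\in\mathbb{R}^n: x+B\subset A\}$ is the Minkowski difference. *)

(* Defs.v *)
From HB Require Import structures.
From mathcomp Require Import all_boot all_order all_algebra.
From mathcomp Require Import finmap.
From mathcomp Require Import all_classical all_reals all_analysis.

Set Implicit Arguments.
Unset Strict Implicit.
Unset Printing Implicit Defensive.

Import Order.TTheory GRing.Theory Num.Theory.
Import numFieldNormedType.Exports.

Local Open Scope classical_set_scope.
Local Open Scope ring_scope.

Definition integer_lattice (R : realType) (n : nat) : set 'rV[R]_n :=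
  [set x | forall i, x ord0 i \is a Num.int].
Arguments integer_lattice : clear implicits.

(* [fset_set] sends an infinite set to [fset0], so [lattice_card M] is the
   number of lattice points of M when there are finitely many of them (e.g. M
   bounded), and 0 otherwise. *)
Definition lattice_card (R : realType) (n : nat) (M : set 'rV[R]_n) : nat :=
  #|` fset_set (M `&` integer_lattice R n) |%fset.

Definition minkowski_sum (V : zmodType) (A B : set V) : set V :=
  [set a + b | a in A & b in B].

Definition set_opp (V : zmodType) (A : set V) : set V := [set - a | a in A].

(* A ~ B, not to be confused with A - B = A + (- B). *)
Definition minkowski_diff (V : zmodType) (A B : set V) : set V :=
  [set x | [set x + b | b in B] `<=` A].

Definition open_cube (R : realType) (n : nat) : set 'rV[R]_n :=
  [set x | forall i, -1 < x ord0 i < 1].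
Arguments open_cube : clear implicits.

(* Main.v *)
(**
  Let C = (-1,1)^n, let A and D be the sets of lattice points of K + C and L + C,
  and let f(x) be the number of y in A with x - y in D, so that f sums to at most
  |A| |D|.  Let S be the set of lattice points of (K + L) ~ C, put G = |S|, and let
  f_0 be the number of lattice points of K meet (-L ~ C).  For t in [0,1), every
  lattice point z within sup-distance < 1 of (1-t) S satisfies f(z) > t^n f_0, and
  the number of such z is at least ((1-t) G^(1/n) + t)^n.  Both facts come from the
  same discrete Brunn-Minkowski inequality for a dilate of a finite set of lattice
  points ([card_dilate_ge]), proved by induction on n by slicing.  The layer cake
  formula then bounds the sum of f below by f_0 times the integral over [0,1] of
  n t^(n-1) ((1-t) G^(1/n) + t)^n, which the Beta integral expands into the sum of
  the statement; the integral is compared with a finite sum through its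
  polynomial primitive.
*)

Require Import Defs.
From HB Require Import structures.
From mathcomp Require Import all_boot all_order all_algebra.
From mathcomp Require Import finmap.
From mathcomp Require Import all_classical all_reals all_analysis.
From mathcomp Require Import zify ring lra polyrcf.

Set Implicit Arguments.
Unset Strict Implicit.
Unset Printing Implicit Defensive.

Import Order.TTheory GRing.Theory Num.Theory.
Import numFieldNormedType.Exports.

Local Open Scope classical_set_scope.
Local Open Scope ring_scope.

(** * Rounding a dilated set of integers on the line *)

Lemma fset_argmax (T : choiceType) d (U : orderType d) (f : T -> U)
  (A : {fset T}) : A != fset0 ->
  exists2 k, k \in A & forall j, j \in A -> (f j <= f k)%O.
Proof.
case/fset0Pn => a aA.
case: (@arg_maxP _ U A [` aA]%fset predT (fun i : A => f (val i)) isT) => i _ imax.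
by exists (val i) => [|j jA]; [exact: valP | exact: (imax [` jA]%fset isT)].
Qed.

(** [clamp01 (x - z)] is the length of the part of [z, z + 1] lying left of x. Summed over z in W,
    it interpolates continuously the number of points of W passed on the way to x. *)
Definition clamp01 (R : realDomainType) (x : R) : R := Num.max 0 (Num.min 1 x).

Section Clamp.
Variable R : realType.
Implicit Types (x s : R) (W : {fset R}).

Lemma clamp01_ge0 x : 0 <= clamp01 x.
Proof. by rewrite /clamp01 le_max lexx. Qed.

Lemma clamp01_le1 x : clamp01 x <= 1.
Proof. by rewrite /clamp01 ge_max ler01 ge_min lexx. Qed.

Lemma clamp01_id x : 0 <= x <= 1 -> clamp01 x = x.
Proof. by case/andP=> x0 x1; rewrite /clamp01 min_r// max_r. Qed.

Lemma clamp01_eq1 x : 1 <= x -> clamp01 x = 1.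
Proof. by move=> x1; rewrite /clamp01 min_l// max_r. Qed.

Lemma clamp01_homo : {homo @clamp01 R : x y / x <= y}.
Proof.
move=> x y xy; rewrite /clamp01 ge_max !le_max lexx /=; apply/orP; right.
by rewrite le_min !ge_min lexx xy orbT.
Qed.

Lemma sum_clamp_homo W x y : x <= y ->
  \sum_(z <- W) clamp01 (x - z) <= \sum_(z <- W) clamp01 (y - z).
Proof. by move=> xy; apply: ler_sum => z _; apply: clamp01_homo; lra. Qed.

(** With m the floor of x, the segment [x, x + s] is covered by [m, m + 1] and, if it goes beyond m
    + 1, by [m + 1, m + 2]. In the latter case x > m, so m + 1 is also at distance < 1 from x and
    belongs to W. *)
Lemma sum_clamp_step W x s : 0 <= s <= 1 ->
  (forall z, z \is a Num.int -> `|z - x| < 1 -> z \in W) ->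
  \sum_(z <- W) clamp01 (x - z) + s <= \sum_(z <- W) clamp01 (x + s - z).
Proof.
move=> s01 nearW; pose m : R := (Num.floor x)%:~R.
have /andP[mx xm] := floor_itv x; rewrite intrD -/m in xm; rewrite -/m in mx.
have mW : m \in W by apply: nearW; rewrite ?intr_int// ltr_norml; lra.
have incr (V : {fset R}) : \sum_(z <- V) clamp01 (x - z) <= \sum_(z <- V) clamp01 (x + s - z).
  by apply: sum_clamp_homo; lra.
rewrite [X in X + s <= _](big_fsetD1 _ mW) [leRHS](big_fsetD1 _ mW)/=.
have [xsm|xsm] := leP (x + s) (m + 1).
  have := incr (W `\ m)%fset.
  by rewrite (@clamp01_id (x - m)) ?(@clamp01_id (x + s - m)); lra.
have m1W : m + 1 \in (W `\ m)%fset.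
  rewrite !inE; apply/andP; split; first by apply/eqP; lra.
  by apply: nearW; rewrite ?rpredD ?intr_int ?int_num1// ltr_norml; lra.
rewrite [X in _ + X + s <= _](big_fsetD1 _ m1W) [X in _ <= _ + X](big_fsetD1 _ m1W)/=.
have := incr (W `\ m `\ (m + 1)%R)%fset.
have := clamp01_ge0 (x - (m + 1)); have := clamp01_le1 (x - (m + 1)).
rewrite (@clamp01_id (x - m)) ?(@clamp01_eq1 (x + s - m)); try lra.
rewrite (@clamp01_id (x + s - (m + 1))); last lra.
suff -> : clamp01 (x - (m + 1)) = 0 by lra.
by rewrite /clamp01 max_l// ge_min; apply/orP; right; lra.
Qed.

End Clamp.

Lemma int_ltD1 (R : archiNumDomainType) (x y : R) :
  x \is a Num.int -> y \is a Num.int -> x < y -> x + 1 <= y.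
Proof.
move=> /intrP[a ->] /intrP[b ->]; rewrite ltr_int => ab.
by rewrite -(intrD _ a 1) ler_int lezD1.
Qed.

(** Consecutive elements of A differ by at least 1, so the points [p + lam * k] advance by at least
    lam. Each advance adds lam to the clamped sum N, and a last step of length 1 beyond the largest
    point adds 1. *)
Lemma card_rounding_ge (R : realType) (lam p : R) (A W : {fset R}) :
  0 <= lam <= 1 -> A != fset0 ->
  (forall k, k \in A -> k \is a Num.int) ->
  (forall k z, k \in A -> z \is a Num.int -> `|z - (p + lam * k)| < 1 -> z \in W) ->
  lam * #|` A|%:R + (1 - lam) <= #|` W|%:R.
Proof.
move=> lam01 A0 Aint nearW.
pose N x : R := \sum_(z <- W) clamp01 (x - z).
have [b bA bmax] := fset_argmax id A0.
(* The final unit step supplies the remaining 1; the advances of length lam are handled by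
   induction, removing the maximum b of A each time. *)
suff H : lam * (#|` A|%:R - 1) <= N (p + lam * b).
  have Nle : N (p + lam * b + 1) <= #|` W|%:R.
    rewrite card_fset_sum1 natr_sum; apply: ler_sum => z _; exact: clamp01_le1.
  have := @sum_clamp_step R W (p + lam * b) 1 _ (fun z => nearW b z bA).
  by rewrite -!/(N _); lra.
move eqn : #|` A| => m; elim: m => [|m IH] in A b A0 Aint nearW bA bmax eqn *.
  by move: A0; rewrite -cardfs_gt0 eqn.
have cA' : #|` (A `\ b)%fset| = m by move: eqn; rewrite (cardfsD1 b) bA => -[].
have [A'0|A'0] := eqVneq (A `\ b)%fset fset0.
  move: cA'; rewrite A'0 cardfs0 => <-; rewrite subrr mulr0.
  by apply: sumr_ge0 => z _; exact: clamp01_ge0.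
have sub k : k \in (A `\ b)%fset -> k \in A by rewrite !inE => /andP[].
have [b' b'A b'max] := fset_argmax id A'0.
have {}IH := IH (A `\ b)%fset b' A'0 (fun k kA => Aint k (sub k kA))
  (fun k z kA => nearW k z (sub k kA)) b'A b'max cA'.
have b'b : b' + 1 <= b.
  apply: int_ltD1; [exact/Aint/sub|exact: Aint|].
  by rewrite lt_neqAle (bmax _ (sub _ b'A)) andbT; move: b'A; rewrite !inE => /andP[].
have := @sum_clamp_step R W (p + lam * b') lam lam01 (fun z => nearW b' z (sub _ b'A)).
have : N (p + lam * b' + lam) <= N (p + lam * b) by apply: sum_clamp_homo; nra.
by rewrite -!/(N _) -[m.+1]addn1 natrD; lra.
Qed.

(** * Weighted counts on the line *)

Lemma sum_indic_le (R : realDomainType) (b : R) (M : nat) : 0 <= b ->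
  \sum_(j < M) (j.+1%:R <= b)%R%:R <= b.
Proof.
move=> b0; elim: M => [|M IH]; first by rewrite big_ord0.
rewrite big_ord_recr /=; have [Mb|Mb] := leP M.+1%:R b; last by rewrite addr0.
apply: le_trans Mb; rewrite -natr1 lerD2r.
apply: (@le_trans _ _ (\sum_(j < M) 1)); last by rewrite sumr_const card_ord.
by apply: ler_sum => i _; rewrite lern1 leq_b1.
Qed.

Lemma sum_ord_ltn (M a : nat) : (\sum_(j < M) (j < a))%N = minn a M.
Proof.
elim: M => [|M IH]; first by rewrite big_ord0 minn0.
by rewrite big_ord_recr /= IH; lia.
Qed.

Lemma powR_invn_exp (R : realType) (n : nat) (x : R) :
  (0 < n)%N -> 0 <= x -> (x `^ n%:R^-1) ^+ n = x.
Proof.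
move=> n0 x0; rewrite -powR_mulrn ?powR_ge0// -powRrM mulVf ?powRr1//.
by rewrite pnatr_eq0 -lt0n.
Qed.

(* Layer cake: apply [card_rounding_ge] to every superlevel set of a. *)
Lemma sum_rounding_ge (R : realType) (lam p : R) (A Z : {fset R})
    (a : R -> nat) (b : R -> R) (k0 : R) :
  0 <= lam <= 1 ->
  (forall k, k \in A -> k \is a Num.int) ->
  (forall z, 0 <= b z) ->
  (forall k z, k \in A -> z \is a Num.int -> `|z - (p + lam * k)| < 1 ->
     z \in Z /\ (a k)%:R <= b z) ->
  k0 \in A -> (forall k, k \in A -> (a k <= a k0)%N) ->
  lam * (\sum_(k <- A) a k)%N%:R + (1 - lam) * (a k0)%:R <= \sum_(z <- Z) b z.
Proof.
move=> lam01 Aint b0 nearZ k0A amax; pose M := a k0.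
pose Aj j := [fset k in A | (j < a k)%N]%fset.
pose Zj j := [fset z in Z | j.+1%:R <= b z]%fset.
have step (j : 'I_M) : lam * #|` Aj j|%:R + (1 - lam) <= #|` Zj j|%:R.
  apply: (card_rounding_ge (p := p)) => //.
  (* The layers stop at [j < a k0], so k0 keeps each of them non-empty; each contributes one term
     [1 - lam]. *)
  - by apply/fset0Pn; exists k0; rewrite !inE k0A /=.
  - by move=> k; rewrite !inE => /andP[/Aint].
  - move=> k z; rewrite !inE => /andP[kA jk] zi zk.
    have [-> /=] := nearZ _ _ kA zi zk; apply: le_trans.
    by rewrite ler_nat.
have -> : (\sum_(k <- A) a k)%N = (\sum_(j < M) #|` Aj j|)%N.
  transitivity (\sum_(k <- A) \sum_(j < M) (j < a k))%N.
    by apply: eq_big_seq => k kA; rewrite sum_ord_ltn; apply/esym/minn_idPl/amax.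
  rewrite exchange_big /=; apply: eq_bigr => j _.
  rewrite card_fset_sum1 big_fset /= [RHS]big_mkcond.
  by apply: eq_bigr => k _; case: ifP.
apply: (@le_trans _ _ (\sum_(j < M) #|` Zj j|%:R)).
  apply: le_trans (ler_sum _ (fun j _ => step j)).
  rewrite big_split /= sumr_const card_ord -mulr_sumr natr_sum.
  by rewrite mulr_natr.
have -> : \sum_(j < M) #|` Zj j|%:R
   = \sum_(z <- Z) \sum_(j < M) (j.+1%:R <= b z)%R%:R :> R.
  rewrite exchange_big /=; apply: eq_bigr => j _.
  rewrite card_fset_sum1 natr_sum big_fset /= [LHS]big_mkcond.
  by apply: eq_bigr => z _; case: ifP.
by apply: ler_sum => z _; exact: sum_indic_le.
Qed.

(** * Discrete Brunn-Minkowski inequality for dilates, by slicing *)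

(** Superadditivity of the weighted geometric mean (Mahler), for the pairs (m, w) and (1, 1). Both
    are normalised by (A, B), their combination with weights lam and mu; after AM-GM the two
    right-hand sides, so weighted, add up to 1. *)
Lemma two_point_mahler (R : realType) (n : nat) (r m w lam mu : R) :
  0 <= r -> 0 < m -> 0 < w -> 0 <= lam -> 0 <= mu -> 0 < lam + mu ->
  r ^+ n.+1 <= m ^+ n * w ->
  (lam * r + mu) ^+ n.+1 <= (lam * m + mu) ^+ n * (lam * w + mu).
Proof.
move=> r0 m0 w0 lam0 mu0 lm0 rmw.
set A := lam * m + mu; set B := lam * w + mu.
have A0 : 0 < A by rewrite /A; nra.
have B0 : 0 < B by rewrite /B; nra.
have AB0 : 0 < A ^+ n * B by rewrite mulr_gt0// exprn_gt0.
pose D := (A ^+ n * B) `^ (n.+1%:R^-1).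
have D0 : 0 < D by rewrite powR_gt0.
have DE : D ^+ n.+1 = A ^+ n * B.
  by rewrite powR_invn_exp// ltW.
(* weighted AM-GM with weights n/(n+1) and 1/(n+1) *)
have amgm (x p q : R) : 0 <= x -> 0 <= p -> 0 <= q -> x ^+ n.+1 <= p ^+ n * q ->
    x / D <= (n%:R * (p / A) + q / B) / n.+1%:R.
  move=> x0 p0 q0 xpq.
  have pA : 0 <= p / A by rewrite divr_ge0// ltW.
  have qB : 0 <= q / B by rewrite divr_ge0// ltW.
  have lhs0 : 0 <= x / D by rewrite divr_ge0// ltW.
  have rhs0 : 0 <= (n%:R * (p / A) + q / B) / n.+1%:R.
    by rewrite divr_ge0// addr_ge0// mulr_ge0.
  rewrite -(@ler_pXn2r _ n.+1)//.
  (* The weights are realised in the unweighted AM-GM by n copies of [p / A] and one of [q / B]. *)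
  pose E (i : 'I_n.+1) := if (i < n)%N then p / A else q / B.
  have Ege0 : {in predT, forall i, 0 <= E i} by move=> i _; rewrite /E; case: ifP.
  have [+ _] := leif_AGM Ege0.
  rewrite card_ord !big_ord_recr /= /E /= ltnn.
  under eq_bigr => i _ do rewrite ltn_ord.
  under [in X in _ <= X -> _]eq_bigr => i _ do rewrite ltn_ord.
  rewrite prodr_const sumr_const card_ord -[p / A *+ n]mulr_natl.
  apply: le_trans.
  by rewrite !expr_div_n DE mulrACA -invfM ler_pM2r ?invr_gt0.
have h1 := amgm r m w r0 (ltW m0) (ltW w0) rmw.
have h2 := amgm 1 1 1 ler01 ler01 ler01.
have Anz : A != 0 by rewrite gt_eqF.
have Bnz : B != 0 by rewrite gt_eqF.
have Nnz : n.+1%:R != 0 :> R by rewrite pnatr_eq0.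
have lr0 : 0 <= lam * r + mu by rewrite addr_ge0// mulr_ge0.
rewrite -DE ler_pXn2r ?nnegrE ?(ltW D0)// -[leRHS]mul1r -ler_pdivrMr//.
have sum1 : (n%:R * (A / A) + B / B) / n.+1%:R = 1.
  by rewrite !divff// mulr1 natr1 divff.
rewrite !expr1n mulr1 in h2; have {}h2 := h2 (lexx _).
rewrite -[leRHS]sum1; have := lerD (ler_wpM2l lam0 h1) (ler_wpM2l mu0 h2).
congr (_ <= _); first by field; rewrite gt_eqF.
rewrite /A /B !mulrDl !mulrDr; ring.
Qed.

Lemma card_fset_fibers (T U : choiceType) (h : T -> U) (S : {fset T}) :
  #|` S| = (\sum_(k <- [fset h s | s in S]%fset)
              #|` [fset s in S | h s == k]%fset|)%N.
Proof.
rewrite card_fset_sum1 (partition_big_imfset _ h)/=; apply: eq_bigr => k _.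
by rewrite card_fset_sum1 big_fset.
Qed.

Lemma col0_eq (R : Type) n (x y : 'rV[R]_n.+1) :
  x ord0 ord0 = y ord0 ord0 -> col' ord0 x = col' ord0 y -> x = y.
Proof.
move=> h t; apply/rowP => j; case: (unliftP ord0 j) => [i|] -> //.
by move/rowP: t => /(_ i); rewrite !mxE.
Qed.

Lemma convex_comb_gt0 (R : realDomainType) (lam x : R) :
  0 <= lam <= 1 -> 0 < x -> 0 < lam * x + (1 - lam).
Proof.
move=> /andP[lam0 lam1] x0; have [->|lamN1] := eqVneq lam 1; first by lra.
rewrite ltr_wpDl ?mulr_ge0 ?(ltW x0)// subr_gt0 lt_neqAle lamN1 lam1 //.
Qed.

(** Slice along the first coordinate: induction bounds the slices of W from below by those of S,
    [sum_rounding_ge] sums these bounds over the first coordinate, and [two_point_mahler] recombines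
    the two factors. The free r stands for an n-th root of the cardinal, so the induction can start
    in dimension 0. *)
Lemma card_dilate_ge (R : realType) (lam : R) n (p : 'rV[R]_n)
    (S W : {fset 'rV[R]_n}) (r : R) :
  0 <= lam <= 1 -> S != fset0 ->
  (forall s, s \in S -> integer_lattice R n s) ->
  (forall s z, s \in S -> integer_lattice R n z ->
     (forall i, `|z ord0 i - (p ord0 i + lam * s ord0 i)| < 1) -> z \in W) ->
  0 <= r -> r ^+ n <= #|` S|%:R ->
  (lam * r + (1 - lam)) ^+ n <= #|` W|%:R.
Proof.
move=> lam01; elim: n => [|n IH] in p S W r *.
  move=> /fset0Pn[s sS] _ nearW _ _; rewrite expr0 ler1n cardfs_gt0.
  by apply/fset0Pn; exists s; apply: (nearW s) => // -[].
move=> S0 Sint nearW r0 rS.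
pose hd (x : 'rV[R]_n.+1) := x ord0 ord0.
pose tl (x : 'rV[R]_n.+1) : 'rV[R]_n := col' ord0 x.
pose fib (X : {fset 'rV[R]_n.+1}) k := [fset x in X | hd x == k]%fset.
pose sec X k := [fset tl x | x in fib X k]%fset.
have secE X k : #|` sec X k| = #|` fib X k|.
  apply: card_in_imfset => x y; rewrite !inE => /andP[_ /eqP xk] /andP[_ /eqP yk].
  by apply: col0_eq; rewrite -/(hd x) -/(hd y) xk yk.
pose A := [fset hd s | s in S]%fset; pose a k := #|` fib S k|.
have fib_gt0 X x : x \in X -> (0 < #|` fib X (hd x)|)%N.
  by move=> xX; rewrite cardfs_gt0; apply/fset0Pn; exists x; rewrite !inE xX eqxx.
have a_gt0 k : k \in A -> (0 < a k)%N by case/imfsetP => s /= sS ->; exact: fib_gt0.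
pose root k : R := (a k)%:R `^ n%:R^-1.
have rootX k : k \in A -> root k ^+ n = (a k)%:R.
  move=> kA; rewrite /root; case: n => [|n] in IH p S W r S0 Sint nearW r0 rS hd tl
     fib sec secE A a fib_gt0 a_gt0 root kA *; last first.
    by rewrite powR_invn_exp.
  (* In dimension 0 the power is 1 whatever the root is, and a non-empty slice lives in a one-point
     space, so [a k] is 1 as well. *)
  rewrite expr0; apply/eqP; rewrite eq_sym pnatr_eq1 eqn_leq a_gt0// andbT.
  rewrite /a -secE; apply: (@leq_trans #|` [fset (0 : 'rV[R]_0)]%fset|).
    by apply/fsubset_leq_card/fsubsetP => x _; rewrite inE thinmx0.
  by rewrite cardfs1.
have A0 : A != fset0.
  by case/fset0Pn: S0 => s sS; apply/fset0Pn; exists (hd s); apply/imfsetP; exists s.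
have [k0 k0A amax] := fset_argmax a A0.
have root_gt0 k : k \in A -> 0 < root k by move=> kA; apply: powR_gt0; rewrite ltr0n a_gt0.
pose m := root k0; have m0 : 0 < m := root_gt0 _ k0A.
pose phi := (lam * m + (1 - lam)) ^+ n.
have phi0 : 0 < phi by rewrite exprn_gt0// convex_comb_gt0.
have M0 : 0 < (a k0)%:R :> R by rewrite ltr0n a_gt0.
(* Scaled so that [a k <= b z] reduces to x (lam m + 1 - lam) <= m (lam x + 1 - lam) for x =
   [root k] <= m. *)
pose b z := #|` fib W z|%:R * (a k0)%:R / phi.
pose Z := [fset hd w | w in W]%fset.
have Aint k : k \in A -> k \is a Num.int.
  by case/imfsetP => s /= sS ->; exact: Sint.
have b0 z : 0 <= b z by rewrite divr_ge0 ?mulr_ge0// ltW.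
have near k z : k \in A -> z \is a Num.int ->
    `|z - (p ord0 ord0 + lam * k)| < 1 -> z \in Z /\ (a k)%:R <= b z.
  move=> kA zint zk.
  have IHk : (lam * root k + (1 - lam)) ^+ n <= #|` fib W z|%:R.
    rewrite -secE; apply: (IH (tl p) (sec S k)); rewrite ?secE ?rootX ?(ltW (root_gt0 _ _))//.
    - by rewrite -cardfs_gt0 secE a_gt0.
    - by move=> _ /imfsetP[/= s /[!inE] /andP[sS _] ->] i; rewrite mxE; exact: Sint.
    move=> _ v /imfsetP[/= s /[!inE] /andP[sS /eqP sk] ->] vint vs.
    pose w : 'rV[R]_n.+1 := \row_j (if unlift ord0 j is Some i then v ord0 i else z).
    have hw : hd w = z by rewrite /hd mxE unlift_none.
    have tw : tl w = v by apply/rowP => i; rewrite !mxE liftK.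
    apply/imfsetP; exists w => //=; rewrite !inE hw eqxx andbT.
    apply: (nearW s) => // j; case: (unliftP ord0 j) => [i|] ->.
    - by rewrite mxE liftK.
    - by rewrite mxE unlift_none.
    - by have := vs i; rewrite !mxE liftK.
    - by rewrite -/(hd w) hw -/(hd s) sk.
  have key : (a k)%:R * phi <= #|` fib W z|%:R * (a k0)%:R.
    rewrite -(rootX _ k0A) -(rootX _ kA) -/m mulrC -exprMn.
    apply: le_trans (ler_wpM2r _ IHk); last by rewrite exprn_ge0// ltW.
    rewrite -exprMn lerXn2r ?nnegrE ?mulr_ge0 ?(ltW (root_gt0 _ _))//;
      try by rewrite ltW// convex_comb_gt0// root_gt0.
    have : root k <= m.
      by apply: ge0_ler_powR; rewrite ?nnegrE ?invr_ge0// ler_nat; exact: amax.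
    nra.
  split; last by rewrite /b ler_pdivlMr.
  (* The bound [key] also forces the slice of W at z to be non-empty, which puts z in Z. *)
  have : 0 < (a k)%:R * phi by rewrite mulr_gt0// ltr0n a_gt0.
  move=> /lt_le_trans /(_ key); rewrite pmulr_lgt0// ltr0n cardfs_gt0.
  case/fset0Pn => w /[!inE] /andP[wW /eqP <-]; by apply/imfsetP; exists w.
have := sum_rounding_ge lam01 Aint b0 near k0A amax.
rewrite -card_fset_fibers -!mulr_suml -natr_sum -card_fset_fibers => key.
(* Since m^n is the largest slice, m^n w is the cardinal of S, and [key] becomes phi (lam w + 1 -
   lam) <= |W|. *)
pose w : R := #|` S|%:R / (a k0)%:R.
have w0 : 0 < w by rewrite divr_gt0// ltr0n cardfs_gt0.
have lamge := lam01; case/andP: lamge => lam0 lam1.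
apply: le_trans (@two_point_mahler R n r m w lam (1 - lam) _ _ _ _ _ _ _) _ => //.
- by rewrite subr_ge0.
- by rewrite addrC subrK.
- by rewrite rootX// mulrC divfK// gt_eqF.
have wM : w * (a k0)%:R = #|` S|%:R by rewrite divfK// gt_eqF.
move: key; rewrite -/phi ler_pdivlMr// -wM => key.
by rewrite -(ler_pM2r M0); move: key; congr (_ <= _); ring.
Qed.

(** * Beta integrals and comparison of the integral with finite sums *)

(* A primitive of [(1 - 'X)^i * 'X^j] vanishing at 0, by repeated integration
   by parts; its value at 1 is the Beta integral. *)
Fixpoint beta_primitive (R : fieldType) (i j : nat) : {poly R} :=
  if i is i'.+1 then
    j.+1%:R^-1 *: ('X^(j.+1) * (1 - 'X) ^+ i + i%:R *: beta_primitive R i' j.+1)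
  else j.+1%:R^-1 *: 'X^(j.+1).

Section BetaPrimitive.
Variable R : numFieldType.

Lemma deriv_beta_primitive i j :
  (beta_primitive R i j)^`() = (1 - 'X) ^+ i * 'X^j.
Proof.
have jnz k : k.+1%:R != 0 :> R by rewrite pnatr_eq0.
elim: i j => [|i IH] j /=; rewrite derivZ.
  by rewrite derivXn -[X in _ *: X]scaler_nat scalerA mulVf// scale1r expr0 mul1r.
apply: (scalerI (jnz j)); rewrite scalerA mulfV// scale1r derivD derivZ IH derivM.
rewrite derivXn deriv_exp derivB derivC derivX sub0r -pred_Sn.
by rewrite -!mul_polyC !polyC_natr; ring.
Qed.

Lemma beta_primitive0 i j : (beta_primitive R i j).[0] = 0.
Proof.
by elim: i j => [|i IH] j; rewrite /= !hornerE ?IH expr0n ?mul0r /= ?mulr0 ?addr0 ?mulr0.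
Qed.

Lemma beta_primitive1 i j :
  (beta_primitive R i j).[1] = (i`! * j`!)%:R / (i + j).+1`!%:R.
Proof.
have f0 k : k`!%:R != 0 :> R by rewrite pnatr_eq0 -lt0n fact_gt0.
elim: i j => [|i IH] j.
  rewrite [beta_primitive _ _ _]/= !hornerE expr1n ?add0n (factS j) ?fact0 !natrM.
  by field; rewrite f0 /= nat1r pnatr_eq0.
have -> : beta_primitive R i.+1 j = j.+1%:R^-1 *:
    ('X^(j.+1) * (1 - 'X) ^+ i.+1 + i.+1%:R *: beta_primitive R i j.+1) by [].
rewrite !hornerE IH subrr expr0n/= mulr0 add0r addnS -addSn.
move: (f0 (i.+1 + j).+1); move: ((i.+1 + j).+1`!%:R : R) => d d0.
rewrite (factS i) (factS j) !natrM.
by field; rewrite d0 nat1r pnatr_eq0.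
Qed.

End BetaPrimitive.

(** For n > 0, the primitive vanishing at 0 of n X^(n-1) (X + (1 - X) g)^n, expanded by the binomial
    formula. The exponent 2n - i - 1 is (n - 1) + (n - i). *)
Definition dilate_primitive (R : fieldType) (n : nat) (g : R) : {poly R} :=
  \sum_(0 <= i < n.+1)
     (n%:R * 'C(n, i)%:R * g ^+ i) *: beta_primitive R i (2 * n - i).-1.

Section DilatePrimitive.
Variables (R : realType) (n : nat) (n_gt0 : (0 < n)%N) (g : R).

Lemma deriv_dilate_primitive :
  (dilate_primitive n g)^`() =
  n%:R *: ('X^(n.-1) * ('X + (1 - 'X) * g%:P) ^+ n).
Proof.
rewrite /dilate_primitive big_mkord raddf_sum exprDn mulr_sumr scaler_sumr.
apply: eq_bigr => i _ /=; rewrite derivZ deriv_beta_primitive.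
have -> : (2 * n - i).-1 = (n.-1 + (n - i))%N by have := ltn_ord i; lia.
by rewrite exprMn exprD -!mul_polyC !polyCM !polyC_natr polyC_exp; ring.
Qed.

Lemma dilate_primitive0 : (dilate_primitive n g).[0] = 0.
Proof.
rewrite /dilate_primitive horner_sum big1// => i _.
by rewrite hornerZ beta_primitive0 mulr0.
Qed.

(** The Beta value i! (2n - i - 1)! / (2n)! is the inverse of (2n - i) C(2n, i), which produces the
    coefficients of the theorem. *)
Lemma dilate_primitive1 : (dilate_primitive n g).[1] =
  \sum_(0 <= i < n.+1)
     n%:R / (2 * n%:R - i%:R) * 'C(n, i)%:R * ('C(2 * n, i)%:R)^-1 * g ^+ i.
Proof.
rewrite /dilate_primitive horner_sum; apply: eq_big_nat => i /andP[_ ile].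
rewrite hornerZ beta_primitive1.
have i2n : (i <= 2 * n)%N by lia.
have -> : (i + (2 * n - i).-1).+1 = (2 * n)%N by lia.
have C0 : 'C(2 * n, i)%:R != 0 :> R by rewrite pnatr_eq0 -lt0n bin_gt0.
have e : 2 * n%:R - i%:R = (2 * n - i)%:R :> R by rewrite natrB// natrM.
have d0 : (2 * n - i)%:R != 0 :> R by rewrite pnatr_eq0; lia.
have f0 k : k`!%:R != 0 :> R by rewrite pnatr_eq0 -lt0n fact_gt0.
rewrite e -(bin_fact i2n) !natrM.
have -> : (2 * n - i)`! = ((2 * n - i) * (2 * n - i).-1`!)%N.
  have p0 : (0 < 2 * n - i)%N by lia.
  by rewrite -[in LHS](prednK p0) factS prednK.
rewrite natrM; field.
by rewrite d0 C0 !f0.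
Qed.

(** As g >= 1, the factor (t + (1 - t) g)^n decreases on [0, 1], so on [a, b] it is at most its
    value at a; the remaining n t^(n-1) integrates to b^n - a^n. The mean value theorem for P
    replaces the integral. *)
Lemma dilate_primitive_incr (a b : R) : 1 <= g -> 0 <= a -> a <= b -> b <= 1 ->
  (dilate_primitive n g).[b] - (dilate_primitive n g).[a]
    <= (a + (1 - a) * g) ^+ n * (b ^+ n - a ^+ n).
Proof.
move=> g1 a0 ab b1; have [->|aNb] := eqVneq a b; first by rewrite !subrr mulr0.
have {ab aNb} ab : a < b by rewrite lt_neqAle aNb.
pose P := (a + (1 - a) * g) ^+ n *: 'X^n - dilate_primitive n g.
have [c /[!in_itv]/= /andP[ac cb]] := poly_mvt P ab.
move=> e; suff : 0 <= P.[b] - P.[a].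
  by rewrite /P !(hornerD, hornerN, hornerZ, hornerXn); lra.
have dP : P^`().[c] =
    n%:R * c ^+ n.-1 * ((a + (1 - a) * g) ^+ n - (c + (1 - c) * g) ^+ n).
  rewrite /P derivB derivZ derivXn deriv_dilate_primitive.
  by rewrite !(hornerD, hornerN, hornerZ, hornerMn, hornerXn, hornerM, horner_exp,
    hornerX, hornerC); ring.
rewrite e dP mulr_ge0//; last by lra.
rewrite mulr_ge0// ?mulr_ge0// ?exprn_ge0//; first by lra.
by rewrite subr_ge0 lerXn2r ?nnegrE//; nra.
Qed.

(** An upper Riemann sum with nodes t_j = (j / F)^(1/n), chosen so that the increments of t^n all
    equal 1 / F. *)
Lemma dilate_primitive_le_sum (F : nat) : 1 <= g -> (0 < F)%N ->
  (dilate_primitive n g).[1] * F%:R <=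
  \sum_(j < F) (let t : R := (j%:R / F%:R) `^ n%:R^-1 in
                (t + (1 - t) * g) ^+ n).
Proof.
move=> g1 F0; pose t j : R := (j%:R / F%:R) `^ n%:R^-1.
have Fn0 : F%:R != 0 :> R by rewrite pnatr_eq0 -lt0n.
have nn0 : n%:R != 0 :> R by rewrite pnatr_eq0 -lt0n.
have q0 j : 0 <= j%:R / F%:R :> R by rewrite divr_ge0.
have tX j : t j ^+ n = j%:R / F%:R.
  by rewrite powR_invn_exp.
have t_le i j : (i <= j)%N -> t i <= t j.
  move=> ij; apply: ge0_ler_powR; rewrite ?nnegrE ?invr_ge0//.
  by rewrite ler_pM2r ?ler_nat// invr_gt0 ltr0n.
have tF : t F = 1 by rewrite /t divff// powR1.
have t0 : t 0%N = 0 by rewrite /t mul0r powR0// invr_eq0.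
rewrite -ler_pdivlMr ?ltr0n// mulr_suml.
have -> : (dilate_primitive n g).[1] =
    (dilate_primitive n g).[t F] - (dilate_primitive n g).[t 0%N].
  by rewrite tF t0 dilate_primitive0 subr0.
rewrite -(big_mkord predT (fun j => (t j + (1 - t j) * g) ^+ n / F%:R)).
rewrite -(@telescope_sumr _ 0 F (fun j => (dilate_primitive n g).[t j]))//.
apply: ler_sum_nat => j /andP[_ jF].
have := @dilate_primitive_incr (t j) (t j.+1) g1.
have -> : t j.+1 ^+ n - t j ^+ n = F%:R^-1.
  by rewrite !tX -mulrBl -natrB// subSnn mul1r.
apply; [exact: powR_ge0 | exact: t_le |].
by rewrite -tF; exact: t_le.
Qed.

(** At the node t_j the threshold t^n F is the integer j, so the Riemann sum is bounded by the
    numbers of x with f x > j, for j < F, whose total is at most the sum of f. *)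
Lemma dilate_primitive_le_layers (T : choiceType) (X : {fset T}) (f : T -> nat)
    (F : nat) : 1 <= g -> (0 < F)%N ->
  (forall t, 0 <= t < 1 ->
     (t + (1 - t) * g) ^+ n <= #|` [fset x in X | t ^+ n * F%:R < (f x)%:R]%fset|%:R) ->
  (dilate_primitive n g).[1] * F%:R <= (\sum_(x <- X) f x)%N%:R.
Proof.
move=> g1 F0 level; apply: le_trans (dilate_primitive_le_sum g1 F0) _.
have Fp : 0 < F%:R :> R by rewrite ltr0n.
apply: (@le_trans _ _ (\sum_(j < F) #|` [fset x in X | (j < f x)%N]%fset|%:R)).
  apply: ler_sum => j _ /=.
  have q0 : 0 <= j%:R / F%:R :> R by rewrite divr_ge0.
  have q1 : j%:R / F%:R < 1 :> R by rewrite ltr_pdivrMr// mul1r ltr_nat.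
  set t := _ `^ _.
  have tX : t ^+ n = j%:R / F%:R.
    by rewrite powR_invn_exp.
  apply: (le_trans (level t _)).
    rewrite powR_ge0 /= ltNge; apply/negP => t1.
    by have := exprn_ege1 n t1; rewrite tX leNgt q1.
  rewrite tX divfK ?gt_eqF// ler_nat; apply/fsubset_leq_card/fsubsetP => x.
  by rewrite !inE ltr_nat.
rewrite -natr_sum ler_nat.
under eq_bigr => j _ do rewrite card_fset_sum1 big_fset /= big_mkcond.
rewrite exchange_big /=; apply: leq_sum => x _.
rewrite (eq_bigr (fun j : 'I_F => nat_of_bool (j < f x)%N)); last by move=> j _; case: ifP.
by rewrite sum_ord_ltn geq_minl.
Qed.

End DilatePrimitive.

(** * Convolution counts and lattice points of bounded sets *)

(** Double counting: for fixed y in A, the map sending x to x - y is injective, so at most |D|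
    values of x qualify. *)
Lemma sum_conv_card_le (T : zmodType) (A D X : {fset T}) :
  (\sum_(x <- X) #|` [fset y in A | (x - y)%R \in D]%fset| <= #|` A| * #|` D|)%N.
Proof.
under eq_bigr => x _ do rewrite card_fset_sum1 big_fset /= big_mkcond.
rewrite exchange_big /= [X in (_ <= X * _)%N]card_fset_sum1 big_distrl /=.
apply: leq_sum => y _; rewrite mul1n -big_mkcond /=.
have -> : (\sum_(x <- X | (x - y)%R \in D) 1)%N =
    #|` [fset x in X | (x - y)%R \in D]%fset|.
  by rewrite card_fset_sum1 big_fset.
set Y := [fset _ in X | _]%fset.
have <- : #|` [fset (x - y)%R | x in Y]%fset| = #|` Y|.
  by apply: card_imfset; exact: addIr.
by apply/fsubset_leq_card/fsubsetP => _ /imfsetP[x /[!inE] /andP[_ xD] ->].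
Qed.

Section LatticePoints.
Variables (R : realType) (n : nat).
Implicit Types A B K L M : set 'rV[R]_n.

Definition coord_bounded A :=
  exists b : R, forall x, A x -> forall i, `|x ord0 i| <= b.

Lemma bounded_set_coord A : bounded_set A -> coord_bounded A.
Proof.
move=> [b [_ Ab]]; exists (b + 1) => x Ax i.
have : mx_norm x <= b + 1 by apply: (Ab (b + 1)) => //; rewrite ltrDl.
by rewrite mx_normrE; apply: le_trans; exact: (le_bigmax _ _ (ord0, i)).
Qed.

Lemma coord_bounded_sub A B : A `<=` B -> coord_bounded B -> coord_bounded A.
Proof. by move=> AB [b Bb]; exists b => x /AB; exact: Bb. Qed.

Lemma coord_bounded_sum A B :
  coord_bounded A -> coord_bounded B -> coord_bounded (minkowski_sum A B).
Proof.
move=> [a Aa] [b Bb]; exists (a + b) => _ [x Ax [y By <-]] i.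
by rewrite mxE (le_trans (ler_normD _ _))// lerD ?Aa ?Bb.
Qed.

Lemma coord_bounded_cube : coord_bounded (open_cube R n).
Proof. by exists 1 => x Cx i; rewrite ler_norml; have := Cx i; lra. Qed.

(** Shifting by an integer N above the bound turns the coordinates into naturals at most 2N, so
    these points lie in the image of a finite type. *)
Lemma finite_lattice A : coord_bounded A -> finite_set (A `&` integer_lattice R n).
Proof.
move=> [b Ab]; pose N := Num.bound `|b|.
pose f (v : 'rV['I_(2 * N).+1]_n) : 'rV[R]_n := \row_j ((v ord0 j : nat)%:R - N%:R).
apply: (@sub_finite_set _ _ (range f)); last exact/finite_image/finite_finset.
move=> x [Ax xint]; pose g (i : 'I_n) : nat := Num.truncn (x ord0 i + N%:R).
have xN i : 0 <= x ord0 i + N%:R <= (2 * N)%:R.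
  have bN : b <= N%:R by exact: le_trans (ler_norm b) (ltW (archi_boundP (normr_ge0 b))).
  by have := Ab _ Ax i; rewrite ler_norml mulnC muln2 -addnn natrD; lra.
have gE i : (g i)%:R = x ord0 i + N%:R.
  apply/eqP; rewrite -natrEtruncn natrEint; case/andP: (xN i) => -> _.
  by rewrite andbT rpredD ?rpred_nat//; exact: xint.
exists (\row_i inord (g i)) => //; apply/rowP => i; rewrite !mxE inordK ?gE ?addrK//.
by rewrite ltnS -(ler_nat R) gE; case/andP: (xN i).
Qed.

Definition lattice_points A : {fset 'rV[R]_n} := fset_set (A `&` integer_lattice R n).

Lemma in_lattice_points A x : coord_bounded A ->
  x \in lattice_points A <-> A x /\ integer_lattice R n x.
Proof.
by move=> bA; rewrite in_fset_set; [rewrite inE | exact: finite_lattice].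
Qed.

Lemma convex_setP A x y (t : R) : convex_set A -> A x -> A y -> 0 <= t <= 1 ->
  A (t *: x + (1 - t) *: y).
Proof.
move=> cA Ax Ay /andP[t0 t1].
have := cA x y (Itv01 t0 t1); rewrite !inE => /(_ Ax Ay).
by [].
Qed.

Lemma cube_opp c : open_cube R n c -> open_cube R n (- c).
Proof. by move=> Cc i; rewrite mxE; have := Cc i; lra. Qed.

Lemma open_cube0 : open_cube R n 0.
Proof. by move=> i; rewrite mxE; lra. Qed.

(* If s + cube is contained in K + L and b + cube in - L, then z = (1-t) s + c,
   with c in the cube, is (1-t)(s + c) + t c, where s + c = k + l; every lattice
   point y near (1-t) k + t b satisfies z - y = (1-t) l + t (c - b) + (cube). *)
Lemma card_level_set_ge (K L : set 'rV[R]_n) (t r : R) :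
  (0 < n)%N -> convex_set K -> convex_set L ->
  coord_bounded K -> coord_bounded L ->
  let M := minkowski_diff (minkowski_sum K L) (open_cube R n) in
  let B := K `&` minkowski_diff (set_opp L) (open_cube R n) in
  let A := lattice_points (minkowski_sum K (open_cube R n)) in
  let D := lattice_points (minkowski_sum L (open_cube R n)) in
  let f (x : 'rV[R]_n) := #|` [fset y in A | (x - y)%R \in D]%fset| in
  let X := [fset (y + d)%R | y in A, d in D]%fset in
  (0 < lattice_card M)%N -> (0 < lattice_card B)%N ->
  0 <= t < 1 -> 0 <= r -> r ^+ n <= (lattice_card M)%:R ->
  (t + (1 - t) * r) ^+ n <=
    #|` [fset x in X | t ^+ n * (lattice_card B)%:R < (f x)%:R]%fset|%:R.
Proof.
move=> n0 cK cL bK bL M B A D f X M0 B0 t01 r0 rM.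
have [t0 t1] := andP t01.
have bM : coord_bounded M.
  apply: coord_bounded_sub (coord_bounded_sum bK bL) => x Mx.
  by apply: Mx; exists 0; rewrite ?addr0//; exact: open_cube0.
have bB : coord_bounded B by apply: coord_bounded_sub bK => x [].
have bA := coord_bounded_sum bK coord_bounded_cube.
have bD := coord_bounded_sum bL coord_bounded_cube.
have -> : t + (1 - t) * r = (1 - t) * r + (1 - (1 - t)) by ring.
(* First use, with factor 1 - t: every lattice point near (1 - t) M has to be placed in the level
   set. *)
apply: (@card_dilate_ge R (1 - t) n 0 (lattice_points M)) => //.
- by lra.
- by rewrite -cardfs_gt0.
- by move=> s /(in_lattice_points _ bM)[].
move=> s z /(in_lattice_points _ bM)[Ms sint] zint zs.
pose c := z - (1 - t) *: s.
have Cc : open_cube R n c.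
  by move=> i; have := zs i; rewrite !mxE ltr_norml; lra.
have [k Kk [l Ll kl]] : minkowski_sum K L (s + c) by apply: Ms; exists c.
(* Second use, with factor t and translation (1 - t) k: the lattice points near (1 - t) k + t B are
   among those counted by [f z]. *)
have level : (t * (lattice_card B)%:R `^ n%:R^-1 + (1 - t)) ^+ n <= (f z)%:R.
  apply: (@card_dilate_ge R t n ((1 - t) *: k) (lattice_points B)) => //.
  - by lra.
  - by rewrite -cardfs_gt0.
  - by move=> b /(in_lattice_points _ bB)[].
  - move=> b y /(in_lattice_points _ bB)[[Kb Lb] bint] yint yb.
    pose e := y - (t *: b + (1 - t) *: k).
    have Ce : open_cube R n e.
      by move=> i; have := yb i; rewrite !mxE ltr_norml; lra.
    have Lcb : L (c - b).
      have [l' Ll' l'E] : set_opp L (b - c).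
        by apply: Lb; exists (- c) => //; exact: cube_opp.
      by rewrite -(opprB b c) -l'E opprK.
    rewrite !inE; apply/andP; split; apply/in_lattice_points => //; split.
    - exists (t *: b + (1 - t) *: k); first by apply: convex_setP => //; lra.
      by exists e => //; rewrite /e addrC subrK.
    - by [].
    - exists (t *: (c - b) + (1 - t) *: l); first by apply: convex_setP => //; lra.
      exists (- e); first exact: cube_opp.
      have lE : l = s + c - k by rewrite -kl addrC addKr.
      by rewrite lE /e /c; apply/rowP => i; rewrite !mxE; ring.
    - by move=> i; rewrite !mxE rpredB ?zint ?yint.
  - by rewrite powR_invn_exp.
(* Strictness comes from dropping the summand 1 - t > 0. *)
have fz : t ^+ n * (lattice_card B)%:R < (f z)%:R.
  apply: lt_le_trans level; set rho := _ `^ _.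
  have <- : rho ^+ n = (lattice_card B)%:R.
    by rewrite powR_invn_exp.
  have rho0 : 0 <= rho by exact: powR_ge0.
  have trho : 0 <= t * rho by exact: mulr_ge0.
  by rewrite -exprMn ltrXn2r ?nnegrE -?lt0n//; lra.
have : (0 < f z)%N.
  by rewrite -(ltr_nat R); apply: le_lt_trans fz; rewrite mulr_ge0// exprn_ge0.
rewrite cardfs_gt0 => /fset0Pn[y /[!inE] /andP[yA zyD]]; rewrite fz andbT.
by apply/imfset2P; exists y => //; exists (z - y) => //; rewrite addrC subrK.
Qed.

End LatticePoints.

(** * The inequality for two sets and its case L = -K *)

Lemma lattice_rogers_shephard (R : realType) (n : nat) (K L : set 'rV[R]_n) :
  (0 < n)%N -> convex_set K -> convex_set L -> bounded_set K -> bounded_set L ->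
  K 0 -> open_cube R n `<=` L ->
  (\sum_(0 <= i < n.+1)
      n%:R / (2 * n%:R - i%:R) * 'C(n, i)%:R * ('C(2 * n, i)%:R)^-1 *
      (lattice_card (minkowski_diff (minkowski_sum K L) (open_cube R n)))%:R
        `^ (i%:R / n%:R))
   * (lattice_card (K `&` minkowski_diff (set_opp L) (open_cube R n)))%:R
   <= (lattice_card (minkowski_sum K (open_cube R n)))%:R
      * (lattice_card (minkowski_sum L (open_cube R n)))%:R :> R.
Proof.
move=> n0 cK cL /bounded_set_coord bK /bounded_set_coord bL K0 CL.
set M := minkowski_diff (minkowski_sum K L) _.
set B := K `&` _.
have [->|] := posnP (lattice_card B); first by rewrite mulr0 -natrM ler0n.
move=> B0; pose g : R := (lattice_card M)%:R `^ n%:R^-1.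
have zint : integer_lattice R n 0 by move=> i; rewrite mxE rpred0.
(* The origin lies in M because the cube is contained in L and 0 in K. This yields g >= 1, the
   monotonicity needed for the Riemann sum. *)
have M0 : (0 < lattice_card M)%N.
  rewrite cardfs_gt0; apply/fset0Pn; exists 0; apply/in_lattice_points; last first.
    by split => // _ [c /CL Lc <-]; exists 0 => //; exists c.
  apply: coord_bounded_sub (coord_bounded_sum bK bL) => x Mx.
  by apply: Mx; exists 0; rewrite ?addr0//; exact: open_cube0.
have g1 : 1 <= g.
  have <- : 1 `^ n%:R^-1 = 1 :> R by rewrite powR1.
  by apply: ge0_ler_powR; rewrite ?nnegrE ?invr_ge0// ler1n.
have gX i : g ^+ i = (lattice_card M)%:R `^ (i%:R / n%:R).
  by rewrite -powR_mulrn ?powR_ge0// -powRrM mulrC.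
under eq_big_nat => i _ do rewrite -gX.
rewrite -dilate_primitive1// -natrM.
set A := lattice_points (minkowski_sum K (open_cube R n)).
set D := lattice_points (minkowski_sum L (open_cube R n)).
pose X := [fset (y + d)%R | y in A, d in D]%fset.
pose f (x : 'rV[R]_n) := #|` [fset y in A | (x - y)%R \in D]%fset|.
apply: (@le_trans _ _ (\sum_(x <- X) f x)%N%:R); last first.
  by rewrite ler_nat; exact: sum_conv_card_le.
apply: dilate_primitive_le_layers => // t t01.
apply: card_level_set_ge => //; first exact: le_trans g1.
by rewrite gX divff ?powRr1// pnatr_eq0 -lt0n.
Qed.

Theorem theorem3p1 (R : realType) (n : nat) (n_ge1 : (1 <= n)%N) :
  (forall K L : set 'rV[R]_n,
     convex_set K ->
     convex_set L ->
     bounded_set K -> bounded_set L ->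
     K 0 -> L 0 ->
     open_cube R n `<=` L ->
     (\sum_(0 <= i < n.+1)
        n%:R / (2 * n%:R - i%:R) * 'C(n, i)%:R * ('C(2 * n, i)%:R)^-1 *
        (lattice_card (minkowski_diff (minkowski_sum K L) (open_cube R n)))%:R
          `^ (i%:R / n%:R))
     * (lattice_card (K `&` minkowski_diff (set_opp L) (open_cube R n)))%:R
     <= (lattice_card (minkowski_sum K (open_cube R n)))%:R
        * (lattice_card (minkowski_sum L (open_cube R n)))%:R :> R)
  /\
  (forall K : set 'rV[R]_n,
     convex_set K ->
     bounded_set K ->
     open_cube R n `<=` K ->
     \sum_(0 <= i < n.+1)
        n%:R / (2 * n%:R - i%:R) * 'C(n, i)%:R * ('C(2 * n, i)%:R)^-1 *
        (lattice_card (minkowski_diff (minkowski_sum K (set_opp K))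
                                      (open_cube R n)))%:R
          `^ (i%:R / n%:R)
     <= (lattice_card (minkowski_sum K (open_cube R n)))%:R ^+ 2
        / (lattice_card (minkowski_diff K (open_cube R n)))%:R :> R).

Proof.
split=> [K L cK cL bK bL K0 _ CL|K cK bK CK].
  exact: lattice_rogers_shephard.
have K0 : K 0 by apply/CK/open_cube0.
have oppK (A : set 'rV[R]_n) : set_opp (set_opp A) = A.
  apply/seteqP; split => [_ [_ [x Ax <-] <-]|x Ax]; first by rewrite opprK.
  by exists (- x); rewrite ?opprK//; exists x.
have cubeN : set_opp (open_cube R n) = open_cube R n.
  apply/seteqP; split => [_ [c Cc <-]|c Cc]; first exact: cube_opp.
  by exists (- c); rewrite ?opprK//; exact: cube_opp.
have cNK : convex_set (set_opp K).
  move=> x y l; rewrite !inE => -[a Ka <-] [b Kb <-].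
  exists (conv l (a : convex_lmodType 'rV[R]_n) b).
    by have := cK a b l; rewrite !inE; apply.
  by rewrite /conv /= opprD -!scalerN.
have bNK : bounded_set (set_opp K).
  move: bK => [b [breal Kb]]; exists b; split=> // b' bb' _ [x Kx <-] /=.
  by rewrite normrN; exact: Kb.
have CNK : open_cube R n `<=` set_opp K.
  by move=> c Cc; exists (- c); rewrite ?opprK//; apply/CK/cube_opp.
(* The cube contains 0, so K ~ C is contained in K and intersecting with K changes nothing. *)
have -> : minkowski_diff K (open_cube R n) =
    K `&` minkowski_diff (set_opp (set_opp K)) (open_cube R n).
  rewrite oppK; apply/seteqP; split => [x Kx|x []//]; split => //.
  by apply: Kx; exists 0; rewrite ?addr0//; exact: open_cube0.
(* The origin lies in K ~ C, so the denominator is positive and the division is a genuine one. *)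
have B0 : (0 < lattice_card
    (K `&` minkowski_diff (set_opp (set_opp K)) (open_cube R n)))%N.
  rewrite oppK cardfs_gt0; apply/fset0Pn; exists 0; apply/in_lattice_points.
    by apply: coord_bounded_sub (bounded_set_coord bK) => x [].
  split; last by move=> i; rewrite mxE rpred0.
  by split=> // _ [c Cc <-]; rewrite add0r; exact: CK.
rewrite ler_pdivlMr ?ltr0n//.
apply: le_trans (lattice_rogers_shephard n_ge1 cK cNK bK bNK K0 CNK) _.
(* It remains to bound the count for -K + C by that for K + C: the cube is symmetric, so negation
   carries one set of lattice points into the other. *)
rewrite expr2 ler_wpM2l// ler_nat.
set A := minkowski_sum K _.
have bA : coord_bounded A.
  exact: coord_bounded_sum (bounded_set_coord bK) (@coord_bounded_cube R n).
have bA' : coord_bounded (minkowski_sum (set_opp K) (open_cube R n)).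
  exact: coord_bounded_sum (bounded_set_coord bNK) (@coord_bounded_cube R n).
have <- : #|` [fset (- x)%R | x in lattice_points A]%fset| = lattice_card A.
  by apply: card_imfset; exact: oppr_inj.
apply/fsubset_leq_card/fsubsetP => x /in_lattice_points -/(_ bA')[].
move=> [_ [k Kk <-] [c Cc <-]] xint; apply/imfsetP; exists (k - c) => /=.
  apply/in_lattice_points => //; split.
    by exists k => //; exists (- c) => //; exact: cube_opp.
  by move=> i; have := xint i; rewrite !mxE -rpredN opprD opprK.
by rewrite opprB addrC.
Qed.
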